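(* Let $M$ be a countable ultrahomogeneous structure in a countable language, and assume that there is a canonical independence relation $\downarrow$ on $M$ which is defined on finitely generated substructures. Then there is a strongly repulsive automorphism in $\mathrm{Aut}(M)$.
   Context: A countable structure $M$ is ultrahomogeneous if every isomorphism between two finitely generated substructures of $M$ extends to an automorphism of $M$. For tuples, $a\equiv b$ means $\mathrm{tp}(a/\emptyset)=\mathrm{tp}(b/\emptyset)$ in $M$, and $a\equiv_C b$ means $\mathrm{tp}(a/C)=\mathrm{tp}(b/C)$. Juxtaposition of sets (e.g. $BC$) denotes union; $A\downarrow B$ means $A\downarrow_\emptyset B$; for finite tuples $a,b,c$ enumerating $A,B,C$, $a\downarrow_c b$ means $A\downarrow_C B$; $\langle A\rangle$ is the substructure generated by $A$. A ternary relation $A\downarrow_C B$ on finite subsets of a countable structure $M$, invariant under $\mathrm{Aut}(M)$, is a canonical independence relation (CIR) if for all finite $A,B,C,D\subseteq M$: (Stationarity over $\emptyset$) if $A\downarrow B$, $A'\downarrow B'$, $a,b,a',b'$ are tuples enumerating $A,B,A',B'$, and $a\equiv a'$, $b\equiv b'$, then $ab\equiv a'b'$; (Extension on the right) if $A\downarrow_C B$ then for every finite tuple $d$ there is $d'\equiv_{BC}d$ such that $A\downarrow_C B\cup d'$; (Transitivity on both sides) if $A\downarrow_{DC}B$ and $D\downarrow_C B$ then $AD\downarrow_C B$; and if $A\downarrow_{DC}B$ and $A\downarrow_C D$ then $A\downarrow_C BD$; (Monotonicity) if $A\downarrow_C B$, $A'\subseteq A$, $B'\subseteq B$ then $A'\downarrow_C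 B'$; (Existence) $A\downarrow_C C$ and $C\downarrow_C A$. (Neither symmetry nor base monotonicity is required.) A CIR is defined on finitely generated substructures if for all finite $A,B,C,A',B',C'\subseteq M$ with $\langle A\rangle=\langle A'\rangle$, $\langle B\rangle=\langle B'\rangle$, $\langle C\rangle=\langle C'\rangle$, we have $A\downarrow_C B$ iff $A'\downarrow_{C'}B'$. $a\downarrow^{ns}b$ means that $\mathrm{tp}(a/b)$ does not split over $\emptyset$: whenever $b',b''$ are finite tuples of elements of $b$ with $b'\equiv b''$, then $b'\equiv_a b''$ (for sets, use tuples enumerating them). An automorphism $\sigma\in\mathrm{Aut}(M)$ is strongly repulsive if for every finite $A\subseteq M$ there is $n$ such that for all $m\ge n$, $A\downarrow^{ns}\sigma^m(A)$ and $\sigma^m(A)\downarrow^{ns}A$. *)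

(* Defs.v *)
From mathcomp Require Import all_boot finmap.

Set Implicit Arguments.
Unset Strict Implicit.
Unset Printing Implicit Defensive.

Local Open Scope fset_scope.

Record countLanguage := CountLanguage {
  fun_sym : countType;
  rel_sym : countType;
  fun_arity : fun_sym -> nat;
  rel_arity : rel_sym -> nat }.

Record countStructure (L : countLanguage) := CountStructure {
  carrier :> countType;
  fun_interp : forall f : fun_sym L, (fun_arity f).-tuple carrier -> carrier;
  rel_interp : forall r : rel_sym L, (rel_arity r).-tuple carrier -> Prop }.

Inductive term (L : countLanguage) (V : Type) : Type :=
| Var of V
| App (f : fun_sym L) of 'I_(fun_arity f) -> term L V.

(* [formula L V] is the type of first-order formulas with free variables in V;
   [All] binds the variable [None].  The missing connectives are definable,
   satisfaction being considered classically. *)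
Inductive formula (L : countLanguage) (V : Type) : Type :=
| Falsum
| Equal of term L V & term L V
| Rel (r : rel_sym L) of 'I_(rel_arity r) -> term L V
| Imp of formula L V & formula L V
| All of formula L (option V).

Fixpoint eval (L : countLanguage) (M : countStructure L) (V : Type)
    (v : V -> M) (t : term L V) : M :=
  match t with
  | Var x => v x
  | App f ts => fun_interp [tuple eval v (ts i) | i < fun_arity f]
  end.

Fixpoint sat (L : countLanguage) (M : countStructure L) (V : Type)
    (phi : formula L V) : (V -> M) -> Prop :=
  match phi with
  | Falsum => fun _ => False
  | Equal t u => fun v => eval v t = eval v u
  | Rel r ts => fun v => rel_interp [tuple eval v (ts i) | i < rel_arity r]
  | Imp phi psi => fun v => sat phi v -> sat psi v
  | All phi => fun v => forall x : M, sat phi (oapp v x)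
  end.

(* Elements of C are the parameters: the formulas of tp(a/C) have free
   variables in 'I_n + C, the parameters being interpreted by themselves. *)
Definition tp (L : countLanguage) (M : countStructure L) (C : {fset M})
    (n : nat) (a : n.-tuple M) (phi : formula L ('I_n + C)) : Prop :=
  sat phi (fun x => match x with inl i => tnth a i | inr c => fsval c end).

Definition eqtp (L : countLanguage) (M : countStructure L) (C : {fset M})
    (n : nat) (a b : n.-tuple M) : Prop :=
  forall phi : formula L ('I_n + C), tp a phi <-> tp b phi.

Inductive generated (L : countLanguage) (M : countStructure L) (A : {fset M}) :
    M -> Prop :=
| generated_mem x : x \in A -> generated A x
| generated_fun (f : fun_sym L) (t : (fun_arity f).-tuple M) :
    (forall i, generated A (tnth t i)) -> generated A (fun_interp t).

(* Only the values of h on S matter: h represents an isomorphism between the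
   substructures of M with underlying sets S and T. *)
Definition isomorphism (L : countLanguage) (M : countStructure L)
    (S T : M -> Prop) (h : M -> M) : Prop :=
  [/\ forall x, S x -> T (h x),
      forall x y, S x -> S y -> h x = h y -> x = y,
      forall y, T y -> exists2 x, S x & h x = y,
      forall (f : fun_sym L) (t : (fun_arity f).-tuple M),
        (forall i, S (tnth t i)) ->
        h (fun_interp t) = fun_interp (map_tuple h t)
    & forall (r : rel_sym L) (t : (rel_arity r).-tuple M),
        (forall i, S (tnth t i)) ->
        rel_interp t <-> rel_interp (map_tuple h t)].

Definition automorphism (L : countLanguage) (M : countStructure L)
    (s : M -> M) : Prop :=
  isomorphism (fun _ : M => True) (fun _ : M => True) s.

Definition ultrahomogeneous (L : countLanguage) (M : countStructure L) : Prop :=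
  forall (A B : {fset M}) (h : M -> M),
    isomorphism (generated A) (generated B) h ->
    exists2 s : M -> M, automorphism s & forall x, generated A x -> s x = h x.

Definition elements (M : countType) (n : nat) (a : n.-tuple M) : {fset M} :=
  [fset x in tval a].

(* Throughout, [ind A C B] stands for "A is independent from B over C". *)
Record canonical_independence (L : countLanguage) (M : countStructure L)
    (ind : {fset M} -> {fset M} -> {fset M} -> Prop) : Prop := {
  ind_invariant : forall (s : M -> M) (A B C : {fset M}), automorphism s ->
    ind A C B <-> ind (s @` A) (s @` C) (s @` B);
  ind_stationarity : forall (n m : nat)
      (a a' : n.-tuple M) (b b' : m.-tuple M),
    ind (elements a) fset0 (elements b) ->
    ind (elements a') fset0 (elements b') ->
    eqtp fset0 a a' -> eqtp fset0 b b' ->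
    eqtp fset0 [tuple of a ++ b] [tuple of a' ++ b'];
  ind_extension : forall A B C : {fset M}, ind A C B ->
    forall (n : nat) (d : n.-tuple M), exists2 d' : n.-tuple M,
      eqtp (B `|` C) d' d & ind A C (B `|` elements d');
  ind_transitivity_left : forall A B C D : {fset M},
    ind A (D `|` C) B -> ind D C B -> ind (A `|` D) C B;
  ind_transitivity_right : forall A B C D : {fset M},
    ind A (D `|` C) B -> ind A C D -> ind A C (B `|` D);
  ind_monotonicity : forall A A' B B' C : {fset M},
    ind A C B -> A' `<=` A -> B' `<=` B -> ind A' C B';
  ind_existence : forall A C : {fset M}, ind A C C /\ ind C C A }.

Definition defined_on_fg (L : countLanguage) (M : countStructure L)
    (ind : {fset M} -> {fset M} -> {fset M} -> Prop) : Prop :=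
  forall A B C A' B' C' : {fset M},
    (forall x, generated A x <-> generated A' x) ->
    (forall x, generated B x <-> generated B' x) ->
    (forall x, generated C x <-> generated C' x) ->
    ind A C B <-> ind A' C' B'.

(* tp(A/B) does not split over the empty set. *)
Definition nonsplit (L : countLanguage) (M : countStructure L)
    (A B : {fset M}) : Prop :=
  forall (n : nat) (b b' : n.-tuple M),
    {subset b <= B} -> {subset b' <= B} -> eqtp fset0 b b' -> eqtp A b b'.

Definition strongly_repulsive (L : countLanguage) (M : countStructure L)
    (s : M -> M) : Prop :=
  forall A : {fset M}, exists n : nat, forall m : nat, (n <= m)%N ->
    nonsplit A (iter m s @` A) /\ nonsplit (iter m s @` A) A.

(* Main.v *)
(* It suffices to find an automorphism s such that every finite A satisfies
   A ind_0 s^m(A) for all large m: by stationarity over the empty set together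
   with ultrahomogeneity, this gives non-splitting in both directions.
   We approximate s by pairs (g, X), where only the action of g on the union of
   the X_i = g^i(X), i < n, is retained in later stages, such that
     X_0 ind_{X_1...X_k} X_{k+1} for 0 < k < n,   and   X_0 ind_0 X_n.
   To absorb a new finite set C, let Y = X_0...X_n C, change g outside
   X_0...X_{n-1} so that the orbit of Y is as free as possible, namely
     Y ind_{X_1...X_n} Y_1   and   Y ind_{Y_1...Y_k} Y_{k+1} for 0 < k < 2n,
   and write E_k = X_k...X_{k+n-1}. Left transitivity yields
   Y ind_{E_k} X_{n+k}, where initial segments of E_k can be dropped from the
   base. Hence Y ind_{X_n} X_{n+1}...X_{2n}; as X_n ind_0 X_{2n}, this gives
   Y ind_0 X_{2n}, then Y ind_0 E_{2n}, and since Y ind_{E_{2n}} Y_{2n}, finally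
   Y ind_0 Y_{2n}. The next approximation is (g, g^{-1}(Y)), with n doubled. *)
Require Import Defs.
From mathcomp Require Import all_boot finmap.
From Stdlib Require Import ClassicalEpsilon.

Set Implicit Arguments.
Unset Strict Implicit.
Unset Printing Implicit Defensive.

Local Open Scope fset_scope.
Local Open Scope nat_scope.

(** * Types and automorphisms in an ultrahomogeneous structure *)

Section Homogeneity.
Variables (L : countLanguage) (M : countStructure L).
Implicit Types (g h : M -> M) (A B C : {fset M}).

Lemma automorphism_id : automorphism (id : M -> M).
Proof.
split=> //; first by move=> y _; exists y.
- by move=> f t _; congr fun_interp; apply: eq_from_tnth => i; rewrite tnth_map.
- move=> r t _; suff -> : map_tuple id t = t by [].
  by apply: eq_from_tnth => i; rewrite tnth_map.
Qed.

Lemma automorphism_comp g h :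
  automorphism g -> automorphism h -> automorphism (g \o h).
Proof.
have mapE k (t : k.-tuple M) : map_tuple (g \o h) t = map_tuple g (map_tuple h t).
  by apply: eq_from_tnth => i; rewrite !tnth_map.
case=> _ gI gS gF gR [_ hI hS hF hR]; split=> //.
- by move=> x y _ _ /= /gI e; apply: hI => //; apply: e.
- move=> z _; have [y _ <-] := gS z I; have [x _ <-] := hS y I.
  by exists x.
- by move=> f t _; rewrite /= hF // gF // mapE.
- by move=> r t _; rewrite mapE -gR // hR.
Qed.

Lemma automorphism_iter g m : automorphism g -> automorphism (iter m g).
Proof.
move=> gA; elim: m => [|m IH]; first exact: automorphism_id.
exact: (automorphism_comp gA IH).
Qed.

Lemma automorphism_preimage g A :
  automorphism g -> exists B : {fset M}, g @` B = A.
Proof.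
case=> _ _ gS _ _; pose k x := epsilon (inhabits x) (fun y => g y = x).
have kK x : g (k x) = x.
  by apply: epsilon_spec (fun y => g y = x) _; have [y _ <-] := gS x I; exists y.
exists (k @` A); apply/fsetP => x; apply/imfsetP/idP => [[y /imfsetP[z zA ->] ->]|xA].
  by rewrite kK.
by exists (k x) => //; apply/imfsetP; exists x.
Qed.

Lemma automorphism_eval V (h : M -> M) (v w : V -> M) (t : term L V) :
  automorphism h -> (forall x, w x = h (v x)) -> eval w t = h (eval v t).
Proof.
case=> _ _ _ hF _ e; elim: t => [x|f ts IH] /=; first exact: e.
rewrite hF //; congr fun_interp; apply: eq_from_tnth => i.
by rewrite !tnth_mktuple tnth_map tnth_mktuple.
Qed.

Lemma automorphism_sat V (h : M -> M) (v w : V -> M) (phi : formula L V) :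
  automorphism h -> (forall x, w x = h (v x)) -> sat phi v <-> sat phi w.
Proof.
move=> hA; have [_ hI hS _ hR] := hA.
elim: {V} phi v w => [V|V t u|V r ts|V p IHp q IHq|V p IHp] v w e /=.
- by [].
- rewrite !(automorphism_eval _ hA e); split=> [->//|]; exact: hI.
- rewrite (hR r) //; set a := map_tuple _ _; set b := [tuple _ | _ < _].
  suff -> : a = b by [].
  apply: eq_from_tnth => i; rewrite !tnth_mktuple tnth_map tnth_mktuple.
  by rewrite (automorphism_eval _ hA e).
- by rewrite (IHp _ _ e) (IHq _ _ e).
- have eh x o : oapp w (h x) o = h (oapp v x o) by case: o.
  split=> s x; last by apply/(IHp _ _ (eh x)).
  by have [y _ <-] := hS x I; apply/(IHp _ _ (eh y)).
Qed.

Lemma automorphism_eqtp h C n (a b : n.-tuple M) :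
  automorphism h -> {in C, forall x, h x = x} ->
  (forall i, h (tnth a i) = tnth b i) -> eqtp C a b.
Proof.
move=> hA hC ab phi; apply: (automorphism_sat _ hA) => -[i|c] //.
by rewrite hC // fsvalP.
Qed.

(** The assignment built into [tp]: an instance of [eqtp] at an atomic formula is, up to conversion,
    a statement about values of terms under it. *)
Definition valuation C n (a : n.-tuple M) (x : 'I_n + C) : M :=
  match x with inl i => tnth a i | inr c => fsval c end.

Lemma generated_eval C n (a : n.-tuple M) x :
  generated (elements a `|` C) x <-> exists t, eval (valuation a (C := C)) t = x.
Proof.
split=> [|[t <-]].
- elim=> {x} [x|f t _ /(_ _)/constructive_indefinite_description ts].
    rewrite !inE => /orP[/tnthP[i ->]|xC]; first by exists (Var _ (inl i)).
    by exists (Var _ (inr [` xC])).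
  exists (App (fun i => sval (ts i))) => /=; congr fun_interp.
  by apply: eq_from_tnth => i; rewrite tnth_mktuple; case: (ts i).
- elim: t => [[i|c]|f ts IH] /=.
  + by apply: generated_mem; rewrite !inE mem_tnth.
  + by apply: generated_mem; rewrite inE fsvalP orbT.
  + by apply: generated_fun => i; rewrite tnth_mktuple.
Qed.

Hypothesis hM : ultrahomogeneous M.

(** Sending the value of a term at [a] to its value at [b] is well defined and injective by the
    equations in the type, and preserves relations by its atomic formulas. Ultrahomogeneity extends
    this isomorphism of generated substructures; elements of [C] are themselves terms, hence
    fixed. *)
Lemma eqtp_automorphism C n (a b : n.-tuple M) : eqtp C a b ->
  exists h, [/\ automorphism h, {in C, forall x, h x = x}
              & forall i, h (tnth a i) = tnth b i].
Proof.
move=> ab; pose va := valuation a (C := C); pose vb := valuation b (C := C).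
pose h x := epsilon (inhabits x) (fun y => exists t, eval va t = x /\ eval vb t = y).
have tuE t u : eval va t = eval va u <-> eval vb t = eval vb u := ab (Equal t u).
have hE t : h (eval va t) = eval vb t.
  have /(epsilon_spec (inhabits (eval va t)))[u [/tuE <- ->]] //:
    exists y, exists u, eval va u = eval va t /\ eval vb u = y.
  by exists (eval vb t), t.
have chooseT k (t : k.-tuple M) :
    (forall i, generated (elements a `|` C) (tnth t i)) ->
    exists ts, t = [tuple eval va (ts i) | i < k].
  move=> /(_ _)/generated_eval/constructive_indefinite_description ts.
  exists (fun i => sval (ts i)); apply: eq_from_tnth => i.
  by rewrite tnth_mktuple; case: (ts i).
have mapE k (ts : 'I_k -> _) : map_tuple h [tuple eval va (ts i) | i < k] =
    [tuple eval vb (ts i) | i < k].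
  by apply: eq_from_tnth => i; rewrite !tnth_mktuple tnth_map tnth_mktuple.
have hiso : isomorphism (generated (elements a `|` C))
                        (generated (elements b `|` C)) h.
  split.
  - by move=> x /generated_eval[t <-]; rewrite hE; apply/generated_eval; exists t.
  - by move=> x y /generated_eval[t <-] /generated_eval[u <-]; rewrite !hE => /tuE.
  - move=> y /generated_eval[t <-]; exists (eval va t) => //.
    by apply/generated_eval; exists t.
  - move=> f t /chooseT[ts ->]; rewrite mapE.
    exact: (hE (App ts)).
  - move=> r t /chooseT[ts ->]; rewrite mapE.
    exact: (ab (Rel ts)).
have [s sA sE] := hM hiso; exists s; split=> // [x xC|i].
  rewrite sE; last by apply: generated_mem; rewrite inE xC orbT.
  exact: (hE (Var _ (inr [` xC]))).
rewrite sE; last by apply: generated_mem; rewrite !inE mem_tnth.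
exact: (hE (Var _ (inl i))).
Qed.

End Homogeneity.

(** * Segments of the orbit of a finite set *)

Section Chains.
Variable T : choiceType.
Implicit Types (g : T -> T) (A B : {fset T}).

(** The segment A_i...A_{j-1}, half-open so that adjacent segments concatenate; E_k is
    [chain g X k (k + n)]. *)
Definition chain g A i j : {fset T} := \bigcup_(l <- index_iota i j) (iter l g @` A).

Lemma chainP g A i j x :
  reflect (exists2 l, i <= l < j & x \in iter l g @` A) (x \in chain g A i j).
Proof.
apply: (iffP (bigfcupP _ _ _ _)) => [[l]|[l lij xl]].
  by rewrite andbT mem_index_iota; exists l.
by exists l => //; rewrite andbT mem_index_iota.
Qed.

Lemma sub_chain g A i j l : i <= l < j -> iter l g @` A `<=` chain g A i j.
Proof. by move=> lij; apply/fsubsetP => x xl; apply/chainP; exists l. Qed.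

Lemma chain_sub g A i j B :
  (forall l, i <= l < j -> iter l g @` A `<=` B) -> chain g A i j `<=` B.
Proof.
by move=> AB; apply/fsubsetP => x /chainP[l /AB/fsubsetP lB /lB].
Qed.

Lemma chain_widen g A i j i' j' : i' <= i -> j <= j' ->
  chain g A i j `<=` chain g A i' j'.
Proof.
move=> ii jj; apply: chain_sub => l /andP[il lj]; apply: sub_chain.
by rewrite (leq_trans ii) // (leq_trans lj).
Qed.

Lemma chain1 g A i : chain g A i i.+1 = iter i g @` A.
Proof.
apply/eqP; rewrite eqEfsubset sub_chain ?leqnn // andbT.
by apply: chain_sub => l; rewrite ltnS -eqn_leq => /eqP ->.
Qed.

Lemma chain_nil g A i : chain g A i i = fset0.
Proof.
apply/eqP; rewrite -fsubset0; apply: chain_sub => l /andP[il li].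
by have := leq_ltn_trans il li; rewrite ltnn.
Qed.

Lemma chain_cat g A i k j : i <= k <= j ->
  chain g A i k `|` chain g A k j = chain g A i j.
Proof.
case/andP=> ik kj; apply/eqP; rewrite eqEfsubset fsubUset !chain_widen //=.
apply: chain_sub => l /andP[il lj]; have [lk|kl] := ltnP l k.
  by apply: fsubsetU; rewrite sub_chain // il.
by apply: fsubsetU; rewrite (@sub_chain _ _ k) ?orbT // kl.
Qed.

Lemma imfset_iter0 g A : iter 0 g @` A = A.
Proof. exact: imfset_id. Qed.

Lemma imfset_iterD g A k l : iter k g @` (iter l g @` A) = iter (k + l) g @` A.
Proof. by rewrite -imfset_comp; apply: eq_imfset => // x /=; rewrite iterD. Qed.

Lemma imfset_iterS g A k : g @` (iter k g @` A) = iter k.+1 g @` A.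
Proof. exact: (imfset_iterD g A 1 k). Qed.

Lemma chain_iter g A i j k : iter k g @` chain g A i j = chain g A (k + i) (k + j).
Proof.
apply/fsetP => x; apply/imfsetP/chainP => [[y /= /chainP[l lij yl] ->]|[l]].
  by exists (k + l); rewrite ?leq_add2l ?ltn_add2l // -imfset_iterD in_imfset.
case/andP=> kil lkj; have kl : k <= l by apply: leq_trans kil; rewrite leq_addr.
rewrite -(subnKC kl) -imfset_iterD => /imfsetP[y /= yl ->]; exists y => //.
by apply/chainP; exists (l - k) => //; rewrite leq_subRL // kil ltn_subLR.
Qed.

Lemma chain_succ g A i j : g @` chain g A i j = chain g A i.+1 j.+1.
Proof. exact: (chain_iter g A i j 1). Qed.

Lemma imfset_iterSr g A k : iter k g @` (g @` A) = g @` (iter k g @` A).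
Proof. by rewrite (imfset_iterD g A k 1) addn1 imfset_iterS. Qed.

Lemma chain_imfset g A i j : chain g (g @` A) i j = g @` chain g A i j.
Proof.
rewrite /chain (big_morph _ (imfsetU g) (imfset0 g)).
by apply: eq_bigr => l _; rewrite imfset_iterSr.
Qed.

(** The first n applications of [g] take place at points of A_0...A_{n-1}, so agreement there
    determines iterates up to exponent n inclusive. *)
Lemma eq_iter_chain g g' A n i x : {in chain g A 0 n, g' =1 g} -> x \in A ->
  i <= n -> iter i g' x = iter i g x.
Proof.
move=> gg xA; elim: i => //= i IH lin; rewrite IH ?gg // 1?ltnW //.
by apply/chainP; exists i => //; apply/imfsetP; exists x.
Qed.

Lemma eq_imfset_chain g g' A n i : {in chain g A 0 n, g' =1 g} -> i <= n ->
  iter i g' @` A = iter i g @` A.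
Proof.
by move=> gg lin; apply: eq_in_imfset => // x xA; apply: eq_iter_chain gg _ _.
Qed.

Lemma eq_chain g g' A n i j : {in chain g A 0 n, g' =1 g} -> j <= n.+1 ->
  chain g' A i j = chain g A i j.
Proof.
move=> gg jn; apply: eq_big_seq => l; rewrite mem_index_iota => /andP[_ lj].
by apply: eq_imfset_chain gg _; rewrite -ltnS (leq_trans lj).
Qed.

End Chains.

(** * Non-splitting and free extension of automorphisms *)

Section Independence.
Variables (L : countLanguage) (M : countStructure L).
Variable ind : {fset M} -> {fset M} -> {fset M} -> Prop.
Hypotheses (hM : ultrahomogeneous M) (hI : canonical_independence ind).
Implicit Types (g h : M -> M) (A B C D X Y Z : {fset M}).

Lemma ind_sub A A' B B' C : ind A C B -> A' `<=` A -> B' `<=` B -> ind A' C B'.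
Proof. exact: (ind_monotonicity hI). Qed.

Lemma ind_base A B C : A `<=` C -> ind A C B.
Proof. by have [_ cb] := ind_existence hI B C => /(ind_sub cb); apply. Qed.

Lemma ind_image g A B C : automorphism g ->
  ind A C B <-> ind (g @` A) (g @` C) (g @` B).
Proof. exact: (ind_invariant hI). Qed.

(** Stationarity, applied with the same enumeration [a] on one side, turns b = b' in type into ab =
    ab' in type; an automorphism realizing this fixes [a] pointwise and moves [b] to [b']. *)
Lemma ind_nonsplit A B : ind A fset0 B -> nonsplit A B /\ nonsplit B A.
Proof.
move=> AB.
have enumE Z : elements (in_tuple (enum_fset Z)) = Z by apply/fsetP=> x; rewrite !inE.
have sub Z n (b : n.-tuple M) : {subset b <= Z} -> elements b `<=` Z.
  by move=> bZ; apply/fsubsetP => x; rewrite inE => /bZ.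
have fixE Z h (z := in_tuple (enum_fset Z)) :
    (forall i, h (tnth z i) = tnth z i) -> {in Z, forall x, h x = x}.
  move=> hZ x xZ; have /tnthP[i ->] : x \in z by [].
  exact: hZ.
split=> n b b' /sub bs /sub b's bb'.
- pose a := in_tuple (enum_fset A).
  have : eqtp fset0 [tuple of a ++ b] [tuple of a ++ b'].
    apply: (ind_stationarity hI) => //; rewrite enumE.
    - exact: ind_sub AB _ _.
    - exact: ind_sub AB _ _.
  move=> /(eqtp_automorphism hM)[h [hA _ hE]].
  apply: (automorphism_eqtp hA) => [|i].
    by apply: fixE => i; have := hE (lshift _ i); rewrite !tnth_lshift.
  by have := hE (rshift _ i); rewrite !tnth_rshift.
- pose a := in_tuple (enum_fset B).
  have : eqtp fset0 [tuple of b ++ a] [tuple of b' ++ a].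
    apply: (ind_stationarity hI) => //; rewrite enumE.
    - exact: ind_sub AB _ _.
    - exact: ind_sub AB _ _.
  move=> /(eqtp_automorphism hM)[h [hA _ hE]].
  apply: (automorphism_eqtp hA) => [|i].
    by apply: fixE => i; have := hE (rshift _ i); rewrite !tnth_rshift.
  by have := hE (lshift _ i); rewrite !tnth_lshift.
Qed.

(** Start from Z independent from g(D) over itself and extend the right side by a copy of g(Z) over
    g(D). An automorphism fixing g(D) and carrying g(Z) to this copy is composed with [g]. *)
Lemma free_extension g D Z : automorphism g ->
  exists g', [/\ automorphism g', {in D, g' =1 g} & ind Z (g @` D) (g' @` Z)].
Proof.
move=> gA; pose E := g @` D; pose d := map_tuple g (in_tuple (enum_fset Z)).
have [ZE _] := ind_existence hI Z E.
have [d' d'd Zd'] := ind_extension hI ZE d.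
have {}d'd : eqtp E d d' by rewrite fsetUid in d'd; move=> phi; symmetry; apply: d'd.
have [h [hA hE hd]] := eqtp_automorphism hM d'd.
exists (h \o g); split.
- exact: automorphism_comp.
- by move=> x xD /=; apply: hE; apply/imfsetP; exists x.
- apply: ind_sub Zd' _ _ => //; apply/fsubsetP => _ /imfsetP[x xZ ->] /=.
  have /tnthP[i xi] : x \in in_tuple (enum_fset Z) by [].
  by have := hd i; rewrite tnth_map -xi => ->; rewrite !inE mem_tnth orbT.
Qed.

Lemma ind_transL A B C D : C `<=` D ->
  ind A D B -> ind D C B -> ind (A `|` D) C B.
Proof.
move=> CD; rewrite -{1}(fsetUidPl _ _ CD); exact: (ind_transitivity_left hI).
Qed.

Lemma free_chain g D Y l : automorphism g -> D `<=` Y ->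
  exists g', [/\ automorphism g', {in D, g' =1 g}, ind Y (g @` D) (g' @` Y) &
    forall k, 0 < k <= l -> ind Y (chain g' Y 1 k.+1) (iter k.+1 g' @` Y)].
Proof.
move=> gA DY; elim: l => [|l [g1 [g1A g1D g1Y g1k]]].
  have [g' [g'A g'D g'Y]] := free_extension D Y gA.
  by exists g'; split=> // k /andP[/leq_trans h /h].
(* Keeping [g1] on Y_0...Y_l fixes Y_1...Y_{l+1}, which becomes the base; only the image of the last
   set Y_{l+1} is chosen afresh, and it contributes Y_{l+2}. *)
have [g' [g'A g'g1]] := free_extension (chain g1 Y 0 l.+1) (chain g1 Y 0 l.+2) g1A.
have sY i j : i <= 0 < j -> Y `<=` chain g1 Y i j.
  by move/(sub_chain g1 Y); rewrite imfset_iter0.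
rewrite chain_succ -(eq_chain 1 g'g1) // -(eq_chain 0 g'g1) // chain_succ => ind'.
exists g'; split=> //.
- move=> x xD; rewrite g'g1 ?g1D //.
  by apply: (fsubsetP (sY _ _ _)) => //; apply: (fsubsetP DY).
- by rewrite (eq_imfset_chain (i := 1) g'g1).
- move=> k /andP[k0]; rewrite leq_eqVlt ltnS => /predU1P[->|kl].
    apply: ind_sub ind' _ _; last by apply: sub_chain; rewrite leqnn.
    by rewrite -{1}(imfset_iter0 g' Y) sub_chain.
  rewrite (eq_imfset_chain g'g1) // (eq_chain 1 g'g1) ?ltnS ?leqW //.
  by apply: g1k; rewrite k0.
Qed.

Lemma ind_iter g k A B C : automorphism g -> ind A C B ->
  ind (iter k g @` A) (iter k g @` C) (iter k g @` B).
Proof. by move=> gA /(ind_image A B C (automorphism_iter k gA)). Qed.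

(** * Independence along a free orbit *)

Section FreeChain.
Variables (g : M -> M) (X Y : {fset M}) (n : nat).
Hypotheses (gA : automorphism g) (XY : chain g X 0 n.+1 `<=` Y).
Hypothesis Xfree : forall k, 0 < k < n ->
  ind X (chain g X 1 k.+1) (iter k.+1 g @` X).
Hypothesis Xn : ind X fset0 (iter n g @` X).
Hypothesis Y1 : ind Y (chain g X 1 n.+1) (g @` Y).
Hypothesis Yfree : forall k, 0 < k < n + n ->
  ind Y (chain g Y 1 k.+1) (iter k.+1 g @` Y).

Lemma chain_sub_iter i j k : k <= i -> j <= k + n.+1 ->
  chain g X i j `<=` iter k g @` Y.
Proof.
move=> ki jk; apply: fsubset_trans (chain_widen _ _ ki jk) _.
by rewrite -[k in chain _ _ k]addn0 -chain_iter; apply: subset_imfset; apply/fsubsetP.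
Qed.

Lemma iter_sub_iter k i : k <= i <= k + n -> iter i g @` X `<=` iter k g @` Y.
Proof.
by case/andP=> ki ik; rewrite -chain1 chain_sub_iter // addnS.
Qed.

(** By induction: shift the previous case by [g], then add Y_0 by left transitivity with [Yfree].
    This is possible because E_{k+1} is contained in Y_k. *)
Lemma ind_window k : 0 < k <= n + n ->
  ind (chain g Y 0 k) (chain g X k (k + n)) (iter k g @` Y).
Proof.
elim: k => // -[_ _|k IH /andP[_ kn]].
  by rewrite chain1 imfset_iter0 add1n.
have /(ind_iter 1 gA) := IH (ltnW kn).
rewrite !chain_iter imfset_iterD !add1n => IH1.
have := ind_transL _ (Yfree (k := k.+1) kn) IH1.
rewrite -{2}(imfset_iter0 g Y) -chain1 chain_cat //.
apply; apply: fsubset_trans (@chain_sub_iter _ _ k.+1 _ _) (sub_chain _ _ _) => //.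
- by rewrite addnS addSn.
- by rewrite ltnS leqnn.
Qed.

Lemma ind_initial r : r < n ->
  ind (chain g X 0 r) (chain g X r n) (iter n g @` X).
Proof.
elim: r => [_|r IH rn]; first by rewrite chain_nil; apply: ind_base.
rewrite -(@chain_cat _ _ _ 0 r) ?leqnSn // chain1.
apply: (ind_transitivity_left hI).
  by rewrite -chain1 chain_cat ?leqnSn 1?ltnW //; apply: IH; apply: ltnW.
have nr : (n - r.+1).+1 = n - r by rewrite subnSK // ltnW.
(* Translating this by g^r gives X_r independent from X_n over X_{r+1}...X_{n-1}, so X_r can move
   from the base to the left side. *)
have /(ind_iter r gA) : ind X (chain g X 1 (n - r.+1).+1) (iter (n - r.+1).+1 g @` X).
  by apply: Xfree; rewrite subn_gt0 rn ltn_subrL; case: (n) rn.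
by rewrite chain_iter imfset_iterD nr subnKC ?addn1 // ltnW // ltnW.
Qed.

(* There is no base monotonicity: a smaller base is reached by absorbing the
   removed part into the left side. *)
Lemma ind_window_tail k s : 0 < k <= n + n -> k <= s < k + n ->
  ind Y (chain g X s (n + k)) (iter (n + k) g @` X).
Proof.
move=> kn /andP[ks sk].
have sn : s - k < n by rewrite ltn_subLR.
have /(ind_iter k gA) := ind_initial sn.
rewrite !chain_iter imfset_iterD addn0 subnKC // => Xk.
have Yk : ind Y (chain g X k s `|` chain g X s (k + n)) (iter (k + n) g @` X).
  rewrite chain_cat; last by rewrite ks ltnW.
  apply: ind_sub (ind_window kn) _ _.
    by rewrite -{1}(imfset_iter0 g Y) sub_chain //; case/andP: kn.
  by rewrite iter_sub_iter // leqnn leq_addr.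
rewrite addnC; apply: ind_sub (ind_transitivity_left hI Yk Xk) _ _ => //.
exact: fsubsetUl.
Qed.

Lemma ind_over_last k : k <= n ->
  ind Y (iter n g @` X) (chain g X n.+1 (n + k).+1).
Proof.
elim: k => [_|k IH kn].
  by rewrite addn0 chain_nil; have [h _] := ind_existence hI Y (iter n g @` X);
    apply: ind_sub h _ _.
rewrite addnS -(@chain_cat _ _ _ _ (n + k).+1) ?chain1; last first.
  by rewrite ltnS leq_addr leqnSn.
(* With s = n the base is X_n...X_{n+k}, that is, X_n together with the right side reached so far,
   as right transitivity requires. *)
have := @ind_window_tail k.+1 n; rewrite addnS kn (leq_trans kn) ?leq_addr //.
move/(_ isT); rewrite ltnS leq_addl => /(_ isT) h.
rewrite fsetUC; apply: (ind_transitivity_right hI); last exact: IH (ltnW kn).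
by rewrite fsetUC -(chain1 _ _ n) chain_cat // leqnSn ltnS leq_addr.
Qed.

(** Right transitivity through X_n, since X_0 is independent from X_n over the empty set. As n
    doubles at each stage, these ranges of exponents together cover all large m. *)
Lemma ind_old m : n <= m <= n + n -> ind X fset0 (iter m g @` X).
Proof.
case/andP=> nm mn.
have XsubY : X `<=` Y.
  by apply: fsubset_trans XY; rewrite -{1}(imfset_iter0 g X) sub_chain.
have h : ind X (iter n g @` X `|` fset0) (chain g X n.+1 (n + n).+1).
  by rewrite fsetU0; apply: ind_sub (ind_over_last (leqnn n)) _ _.
have := ind_transitivity_right hI h Xn; rewrite fsetUC -{1}chain1 chain_cat => [e|].
  by apply: ind_sub e _ _ => //; apply: sub_chain; rewrite nm.
by rewrite leqnSn ltnS leq_addr.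
Qed.

Lemma ind_far_window j : 0 < n -> j < n ->
  ind Y fset0 (chain g X (n + n) (n + n + j).+1).
Proof.
move=> n0; elim: j => [_|j IH jn].
  rewrite addn0 chain1.
  have /(ind_iter n gA) := Xn; rewrite imfset0 imfset_iterD => Xnn.
  have h : ind Y (iter n g @` X `|` fset0) (iter (n + n) g @` X).
    rewrite fsetU0; apply: ind_sub (ind_over_last (leqnn n)) _ _ => //.
    by apply: sub_chain; rewrite ltnS leqnn andbT -addn1 leq_add2l.
  exact: ind_sub (ind_transitivity_left hI h Xnn) (fsubsetUl _ _) _.
rewrite addnS -(@chain_cat _ _ _ _ (n + n + j).+1) ?chain1; last first.
  by rewrite leqnSn leqW ?leq_addr.
have h : ind Y (chain g X (n + n) (n + n + j).+1) (iter (n + n + j).+1 g @` X).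
  (* The tail lemma is used with k = n + j + 1 and s = 2n; j < n keeps k within 2n. *)
  have -> : (n + n + j).+1 = n + (n + j.+1) by rewrite addnA addnS.
  apply: ind_window_tail; first by rewrite addn_gt0 n0 leq_add2l (ltnW jn).
  by rewrite leq_add2l (ltnW jn) //= -addnA ltn_add2l addSn ltnS leq_addl.
rewrite fsetUC; apply: (ind_transitivity_right hI); last exact: IH (ltnW jn).
by rewrite fsetU0.
Qed.

Lemma ind_new : 0 < n -> ind Y fset0 (iter (n + n) g @` Y).
Proof.
move=> n0.
have := ind_far_window n0 (j := n.-1); rewrite -addnS prednK // => /(_ (leqnn n)) Yn.
have h : ind Y (chain g X (n + n) (n + n + n) `|` fset0) (iter (n + n) g @` Y).
  rewrite fsetU0; apply: ind_sub (ind_window _) _ _ => //.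
    by rewrite addn_gt0 n0 leqnn.
  by rewrite -{1}(imfset_iter0 g Y) sub_chain // addn_gt0 n0.
apply: ind_sub (ind_transitivity_right hI h Yn) _ (fsubsetUl _ _) => //.
Qed.

End FreeChain.

(** * Finite approximations and their limit *)

Definition free_orbit n g X : Prop :=
  [/\ automorphism g,
      forall k, 0 < k < n -> ind X (chain g X 1 k.+1) (iter k.+1 g @` X)
    & ind X fset0 (iter n g @` X)].

Lemma free_orbit_step n g X C : 0 < n -> free_orbit n g X ->
  exists g' X', [/\ free_orbit (n + n) g' X', {in chain g X 0 n, g' =1 g},
    chain g X 0 n.+1 `|` C `<=` g' @` X'
    & forall m, n <= m <= n + n -> ind X fset0 (iter m g' @` X)].
Proof.
move=> n0 [gA Xfree Xn]; pose Y := chain g X 0 n.+1 `|` C.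
have DY : chain g X 0 n `<=` Y by apply: fsubsetU; rewrite chain_widen.
have [g' [g'A g'g]] := free_chain (n + n) gA DY.
rewrite chain_succ -(eq_chain 1 g'g) // => Y1 Yfree.
(* Since [g'] agrees with [g] on X_0...X_{n-1}, the sets X_0,...,X_n are unchanged and the
   hypotheses on [X] carry over to [g']. *)
have XY : chain g' X 0 n.+1 `<=` Y by rewrite (eq_chain 0 g'g) // fsubsetUl.
have X'free k : 0 < k < n -> ind X (chain g' X 1 k.+1) (iter k.+1 g' @` X).
  move=> kn; have /andP[_ kn'] := kn.
  rewrite (eq_chain _ g'g) ?(eq_imfset_chain g'g) ?ltnS ?(ltnW kn') //.
  exact: Xfree.
have X'n : ind X fset0 (iter n g' @` X) by rewrite (eq_imfset_chain g'g).
have Yfree' k : 0 < k < n + n -> ind Y (chain g' Y 1 k.+1) (iter k.+1 g' @` Y).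
  by case/andP=> k0 kn; apply: Yfree; rewrite k0 ltnW.
have Ynn := ind_new g'A XY X'free X'n Y1 Yfree' n0.
have [X' X'Y] := automorphism_preimage Y g'A.
(* Passing from Y to its preimage puts Y, hence C, both in the domain and in
   the range of the part of g' that later stages keep. *)
exists g', X'; split=> //; last exact: ind_old g'A XY X'free X'n Y1 Yfree'.
  split=> // [k kn|]; apply/(ind_image _ _ _ g'A).
  - by rewrite -chain_imfset -imfset_iterSr X'Y; apply: Yfree'.
  - by rewrite imfset0 -imfset_iterSr X'Y.
by rewrite X'Y.
Qed.

(** Dependent recursion on [free_orbit_step], starting from the identity and the empty set. The
    initial length is 2, so every length exceeds 1 and g(X) lies in the retained part
    X_0...X_{n-1}. *)
Lemma free_orbit_sequence (C : nat -> {fset M}) :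
  exists (g : nat -> M -> M) (X : nat -> {fset M}), forall s (n := 2 ^ s.+1),
  [/\ automorphism (g s), {in chain (g s) (X s) 0 n, g s.+1 =1 g s},
      chain (g s) (X s) 0 n.+1 `|` C s `<=` g s.+1 @` X s.+1
    & forall m, n <= m <= n + n -> ind (X s) fset0 (iter m (g s.+1) @` X s)].
Proof.
pose S s := {p : (M -> M) * {fset M} | free_orbit (2 ^ s.+1) p.1 p.2}.
have S0 : S 0.
  exists (id, fset0); split; first exact: automorphism_id.
  - by move=> k _; apply: ind_sub (ind_base _ (fsubset_refl _)) (fsub0set _) _.
  - exact: ind_base.
have next s (p : S s) : {q : S s.+1 |
    [/\ {in chain (sval p).1 (sval p).2 0 (2 ^ s.+1), (sval q).1 =1 (sval p).1},
        chain (sval p).1 (sval p).2 0 (2 ^ s.+1).+1 `|` C s `<=`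
          (sval q).1 @` (sval q).2
      & forall m, 2 ^ s.+1 <= m <= 2 ^ s.+1 + 2 ^ s.+1 ->
          ind (sval p).2 fset0 (iter m (sval q).1 @` (sval p).2)]}.
  apply: constructive_indefinite_description; case: p => -[g X] /= free.
  have n0 : 0 < 2 ^ s.+1 by rewrite expn_gt0.
  have [g' [X' [free' ? ? ?]]] := free_orbit_step (C s) n0 free.
  have {}free' : free_orbit (2 ^ s.+2) g' X' by rewrite expnS mul2n -addnn.
  by exists (exist (fun p => free_orbit _ p.1 p.2) (g', X') free').
pose f := fix f s : S s := if s is s'.+1 then sval (next s' (f s')) else S0.
exists (fun s => (sval (f s)).1), (fun s => (sval (f s)).2) => s n.
have [] := svalP (next s (f s)) => *.
by split=> //; case: (svalP (f s)).
Qed.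

Lemma repulsive_automorphism :
  exists2 g, automorphism g & forall A, exists n, forall m, n <= m ->
    ind A fset0 (iter m g @` A).
Proof.
(* The sets [C s] run through all singletons of the countable carrier. *)
pose C (s : nat) : {fset M} := if choice.unpickle s is Some x then [fset x] else fset0.
have [g [X gX]] := free_orbit_sequence C.
pose n s := 2 ^ s.+1; pose K s := chain (g s) (X s) 0 (n s).
pose gX' s := g s @` X s.
have n1 s : 1 < n s by rewrite /n expnS -{1}[2]muln1 leq_mul2l expn_gt0.
have gA s : automorphism (g s) by case: (gX s).
have gS s : {in K s, g s.+1 =1 g s} by case: (gX s).
have KgX s : K s `<=` gX' s.+1.
  have [_ _ h _] := gX s; apply: fsubset_trans h; apply: fsubsetU.
  by rewrite chain_widen.
have CgX s : C s `<=` gX' s.+1.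
  by have [_ _ h _] := gX s; apply: fsubset_trans h; apply: fsubsetUr.
have XK s : X s `<=` K s.
  by rewrite -{1}(imfset_iter0 (g s) (X s)) sub_chain //= ltnW.
have gXK s : gX' s `<=` K s by rewrite (@sub_chain _ _ _ _ _ 1) // n1.
have KK s t : s <= t -> K s `<=` K t.
  move/subnK <-; elim: (t - s) => // d IH; rewrite addSn.
  by apply: fsubset_trans IH (fsubset_trans (KgX _) (gXK _)).
have gXX s t : s <= t -> gX' s `<=` gX' t.
  move/subnK <-; elim: (t - s) => // d IH; rewrite addSn.
  by apply: fsubset_trans IH (fsubset_trans (gXK _) (KgX _)).
have gt s t : s <= t -> {in K s, g t =1 g s}.
  move/subnK <-; elim: (t - s) => // d IH x xK; rewrite addSn -IH // gS //.
  by apply: (fsubsetP (KK _ _ _)) xK; rewrite leq_addl.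
have inK x : x \in gX' (choice.pickle x).+1.
  by apply: (fsubsetP (CgX _)); rewrite /C choice.pickleK inE.
have subK A : exists s, A `<=` gX' s.
  exists (\max_(x <- A) (choice.pickle x).+1); apply/fsubsetP => x xA.
  by apply: (fsubsetP (gXX _ _ _)) (inK x); apply: leq_bigmax_seq.
(* The limit map: stage pickle x + 1 is one at which [x] is known to lie in the retained part, and
   later stages give the same value. *)
pose h x := g (choice.pickle x).+1 x.
have hE s x : x \in K s -> h x = g s x.
  move=> xs; have xp := fsubsetP (gXK _) _ (inK x).
  have [sp|/ltnW ps] := leqP s (choice.pickle x).+1; first exact: gt.
  by rewrite (gt _ _ ps).
have subKt k (t : k.-tuple M) : exists s, forall i, tnth t i \in K s.
  have [s ts] := subK [fset x in tval t]; exists s => i.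
  by apply: (fsubsetP (gXK _)); apply: (fsubsetP ts); rewrite inE mem_tnth.
(* Each condition involves finitely many points, all in some [K s], where [h] is [g s]; surjectivity
   holds because every point lies in some g_s(X_s). *)
have hA : automorphism h.
  split=> // [x y _ _|y _|f t _|r t _].
  - have [s xys] := subK [fset x; y]; have {}xys := fsubset_trans xys (gXK s).
    have [_ gI _ _ _] := gA s; rewrite !(hE s) => [/gI||]; first exact.
      by apply: (fsubsetP xys); rewrite !inE eqxx orbT.
    by apply: (fsubsetP xys); rewrite !inE eqxx.
  - have /imfsetP[x /= xX ->] := inK y; exists x => //.
    by apply: hE; apply: (fsubsetP (XK _)).
  - have [s ts] := subKt _ [tuple of fun_interp t :: t].
    have [_ _ _ gF _] := gA s; rewrite (hE s); last exact: (ts ord0).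
    rewrite gF //; congr fun_interp; apply: eq_from_tnth => i.
    by rewrite !tnth_map (hE s) //; have := ts (lift ord0 i); rewrite tnthS.
  - have [s ts] := subKt _ t; have [_ _ _ _ gR] := gA s.
    suff -> : map_tuple h t = map_tuple (g s) t by apply: gR.
    by apply: eq_from_tnth => i; rewrite !tnth_map (hE s).
exists h => // A; have [s As] := subK A; exists (n s) => m sm.
(* The stage t for which 2^(t+1) <= m < 2^(t+2). *)
pose t := (trunc_log 2 m).-1.
have m0 : 0 < m by apply: leq_trans sm; rewrite expn_gt0.
have sl : s < trunc_log 2 m by apply: trunc_log_max.
have l0 : 0 < trunc_log 2 m by apply: leq_trans sl.
have tm : n t <= m < n t + n t.
  by rewrite /n addnn -mul2n -expnS prednK // trunc_logP // trunc_log_ltn.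
have st : s <= t by rewrite -ltnS prednK.
case/andP: tm => tm mt.
have [_ _ _ /(_ m)] := gX t; rewrite -/(n t) tm ltnW // => /(_ isT).
have gt1X : g t.+1 @` X t = gX' t.
  by apply: eq_in_imfset => // x /(fsubsetP (XK t))/gS.
move/(ind_image _ _ _ (gA t.+1)); rewrite imfset0 -imfset_iterSr gt1X => indt.
have At := fsubset_trans As (gXX _ _ st).
suff -> : iter m h @` A = iter m (g t.+1) @` A.
  by apply: (ind_sub indt At); apply: subset_imfset; apply/fsubsetP.
(* Write x as g_{t+1}(z) with z in X_{t+1}. The points at which [h] is applied are g_{t+1}^{i+1}(z)
   with i + 1 <= m < n_{t+1}, so they stay in K_{t+1}, where [h] is g_{t+1}. *)
apply: eq_in_imfset => // x /(fsubsetP At)/(fsubsetP (gXK t))/(fsubsetP (KgX t)).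
case/imfsetP=> z /= zX ->.
have : m < n t.+1 by rewrite /n expnS mul2n -addnn.
elim: (m) => //= i IH im; rewrite IH 1?ltnW //; apply: hE.
rewrite -iterSr; apply/chainP; exists i.+1; first exact: im.
by apply/imfsetP; exists z.
Qed.

End Independence.

Theorem theorem3p12 (L : countLanguage) (M : countStructure L)
    (hM : ultrahomogeneous M)
    (hind : exists2 ind : {fset M} -> {fset M} -> {fset M} -> Prop,
      canonical_independence ind & defined_on_fg ind) :
  exists2 s : M -> M, automorphism s & strongly_repulsive s.
Proof.
case: hind => ind hI _; have [g gA gE] := repulsive_automorphism hM hI.
exists g => // A; have [n An] := gE A; exists n => m /An.
exact: ind_nonsplit.
Qed.
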